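(* Let $a\in\mathcal{B}$, write $\xi_0=\xi_0(a)$, and assume that $m+q\le 2$. Introduce $$K_1:=\left(\frac{m-q}{\sqrt{2m(m+q)}}\right)^{2/(m-q)},\qquad K_2(z):=\left(\sqrt{1+\frac{\beta^2z^2}{2m(m+q)}}-\frac{\beta z}{\sqrt{2m(m+q)}}\right)^{2/(m-q)}.$$ Then the behavior of $f(\xi;a)$ as $\xi\to\xi_0$ (from the left) is given by $$f(\xi;a)=K_1\,\xi_0^{\sigma/(m-q)}(\xi_0-\xi)^{2/(m-q)}+o\big((\xi_0-\xi)^{2/(m-q)}\big)$$ when $m+q\in(1,2)$, and by $$f(\xi;a)=K_1\,\xi_0^{\sigma/(m-q)}\,K_2\big(\xi_0^{(2-\sigma)/2}\big)\,(\xi_0-\xi)^{2/(m-q)}+o\big((\xi_0-\xi)^{2/(m-q)}\big)$$ when $m+q=2$.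
   Context: Standing assumptions: $N\ge1$ is an integer, $m>1$, $q\in(0,1)$, $\sigma>\frac{2(1-q)}{m-1}$, and $$\alpha=\frac{\sigma+2}{\sigma(m-1)+2(q-1)}>0,\qquad \beta=\frac{m-q}{\sigma(m-1)+2(q-1)}>0.$$ For $a>0$, $F(\cdot;a)\in C^2([0,\xi_{\max}(a)))$ is the unique positive solution, on its maximal interval $[0,\xi_{\max}(a))$, of $$F''(\xi)+\frac{N-1}{\xi}F'(\xi)+\alpha F^{1/m}(\xi)-\beta\xi(F^{1/m})'(\xi)-\xi^\sigma F^{q/m}(\xi)=0,\qquad F(0)=a^m,\ F'(0)=0,$$ where either $\xi_{\max}(a)=\infty$, or $\xi_{\max}(a)<\infty$ and $F(\xi;a)+1/F(\xi;a)\to\infty$ as $\xi\to\xi_{\max}(a)$. Set $f(\cdot;a):=F(\cdot;a)^{1/m}$. $\xi_0(a)\in(0,\infty]$ is the first zero of $F(\cdot;a)$: $\xi_0(a)=\xi_{\max}(a)$ if $\xi_{\max}(a)<\infty$ and $F(\xi;a)\to0$ as $\xi\to\xi_{\max}(a)$ (then $F(\xi_0(a);a)=f(\xi_0(a);a)=0$ and $(f^m)'(\xi_0(a);a)$ is the left derivative), and $\xi_0(a)=\infty$ otherwise. Also $\xi_1(a):=\sup\{\xi\in(0,\xi_0(a)),\ \xi<\xi_{\max}(a): F'(\cdot;a)<0\text{ on }(0,\xi)\}>0$. The sets are $$\mathcal{A}:=\{a>0:\ \xi_0(a)<\infty\text{ and }(f^m)'(\xi;a)<0\text{ for }\xi\in(0,\xi_0(a)]\},\quad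 \mathcal{C}:=\{a>0:\ \xi_1(a)<\xi_0(a)\},\quad \mathcal{B}:=(0,\infty)\setminus(\mathcal{A}\cup\mathcal{C}).$$ For $a\in\mathcal{B}$ one has $\xi_0(a)<\infty$. *)

(* Defs.v *)
From Stdlib Require Import Reals ClassicalEpsilon.
From Coquelicot Require Import Coquelicot.
Open Scope R_scope.

Definition alpha (m q sigma : R) : R :=
  (sigma + 2) / (sigma * (m - 1) + 2 * (q - 1)).

Definition beta (m q sigma : R) : R :=
  (m - q) / (sigma * (m - 1) + 2 * (q - 1)).

(* Derivative of f at x relative to D: one-sided at an endpoint of D, and
   equal to [is_derive] at an interior point. *)
Definition is_derive_within (D : R -> Prop) (f : R -> R) (x l : R) : Prop :=
  filterlim (fun y => (f y - f x) / (y - x)) (within D (locally' x)) (locally l).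

Definition C2_on (D : R -> Prop) (f : R -> R) : Prop :=
  exists f1 f2 : R -> R,
    (forall x, D x -> is_derive_within D f x (f1 x)) /\
    (forall x, D x -> is_derive_within D f1 x (f2 x)) /\
    continuous_on D f2.

Definition dom (xm : Rbar) (x : R) : Prop := 0 <= x /\ Rbar_lt x xm.

(* F is a positive solution of the Cauchy problem with F(0) = a^m, F'(0) = 0,
   on its maximal interval [0, xm).  F is a total function whose values outside
   [0, xm) are irrelevant.  The bases of all occurrences of [Rpower] are
   positive, where it is the usual real power (note [Rpower 0 y = 1]). *)
Record is_maximal_solution (N : nat) (m q sigma a : R)
    (F : R -> R) (xm : Rbar) : Prop := {
  sol_xm_pos : Rbar_lt 0 xm;
  sol_C2 : C2_on (dom xm) F;
  sol_pos : forall x, dom xm x -> 0 < F x;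
  sol_init : F 0 = Rpower a m;
  sol_init' : is_derive_within (dom xm) F 0 0;
  sol_ode : forall x, 0 < x -> Rbar_lt x xm ->
    Derive_n F 2 x + (INR N - 1) / x * Derive F x
    + alpha m q sigma * Rpower (F x) (1 / m)
    - beta m q sigma * x * Derive (fun y => Rpower (F y) (1 / m)) x
    - Rpower x sigma * Rpower (F x) (q / m) = 0;
  sol_max : xm = p_infty \/
    exists x : R, xm = Finite x /\
      filterlim (fun y => F y + 1 / F y) (at_left x) (Rbar_locally p_infty)
}.

Definition profile (m : R) (F : R -> R) (x : R) : R := Rpower (F x) (1 / m).

Definition vanishes_at_end (F : R -> R) (xm : Rbar) : Prop :=
  exists x : R, xm = Finite x /\ filterlim F (at_left x) (locally 0).

Definition xi0 (F : R -> R) (xm : Rbar) : Rbar :=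
  if excluded_middle_informative (vanishes_at_end F xm) then xm else p_infty.

Definition xi1 (F : R -> R) (xm : Rbar) : Rbar :=
  Lub_Rbar (fun x => 0 < x /\ Rbar_lt x (xi0 F xm) /\ Rbar_lt x xm /\
                     forall y, 0 < y < x -> Derive F y < 0).

(* F extended by 0 to the right of its maximal interval; only the value at
   the first zero is used. *)
Definition extend0 (F : R -> R) (xm : Rbar) (x : R) : R :=
  if Rbar_lt_dec x xm then F x else 0.

(* In the following sets, [F a] is the solution with F(0) = a^m and [xm a] is
   the right end of its maximal interval; f^m is F. *)
Definition setA (F : R -> R -> R) (xm : R -> Rbar) (a : R) : Prop :=
  0 < a /\
  exists x0 : R, xi0 (F a) (xm a) = Finite x0 /\
    (forall x, 0 < x < x0 -> Derive (F a) x < 0) /\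
    exists l : R, l < 0 /\
      is_derive_within (fun x => x < x0) (extend0 (F a) (xm a)) x0 l.

Definition setC (F : R -> R -> R) (xm : R -> Rbar) (a : R) : Prop :=
  0 < a /\ Rbar_lt (xi1 (F a) (xm a)) (xi0 (F a) (xm a)).

Definition setB (F : R -> R -> R) (xm : R -> Rbar) (a : R) : Prop :=
  0 < a /\ ~ (setA F xm a \/ setC F xm a).

Definition K1 (m q : R) : R :=
  Rpower ((m - q) / sqrt (2 * m * (m + q))) (2 / (m - q)).

Definition K2 (m q sigma z : R) : R :=
  Rpower (sqrt (1 + (beta m q sigma) ^ 2 * z ^ 2 / (2 * m * (m + q)))
          - beta m q sigma * z / sqrt (2 * m * (m + q)))
         (2 / (m - q)).

(* f(x) = c (x0 - x)^p + o((x0 - x)^p) as x -> x0 from the left;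
   [is_domin F g h] means h = o(g) along the filter F. *)
Definition left_expansion (f : R -> R) (x0 c p : R) : Prop :=
  is_domin (at_left x0) (fun x => Rpower (x0 - x) p)
    (fun x => f x - c * Rpower (x0 - x) p).

(* Main.v *)
Require Import Defs.
From Stdlib Require Import Reals Lra ClassicalEpsilon.
From Coquelicot Require Import Coquelicot.
Open Scope R_scope.

(* Compare the decreasing solution with the curves [- F' = k F^((m+q)/(2m))] of the
   phase plane.  Writing [E_k = F'^2 - k^2 F^((m+q)/m)], the sign of [E_k'] where the
   solution crosses such a curve is that of a quantity which, near the zero [x0], tends to
     [(m+q)/(2m) k^2 + (beta/m) w k - x0^sigma],
   with [w = x0] if [m + q = 2] and [w = 0] if [m + q < 2].  Let [Y] be its positive root.
   For [k < Y] the solution cannot come back from [E_k <= 0], for [k > Y] it cannot come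
   back from [E_k >= 0]; since [E_k -> 0] at [x0] (because [a] is not in A, so
   [F'(x0) = 0]), both are impossible.  Hence [- F' / F^((m+q)/(2m)) -> Y], i.e. the
   derivative of [F^((m-q)/(2m))] tends to [- (m-q)/(2m) Y], which is the expansion.
   The same curve with [k = 1] shows that [x0] is finite, using that [m + q <= 2] forces
   [sigma > 2]. *)

(** * Limits and barriers *)

Lemma at_left_iff (X : R) (P : R -> Prop) :
  at_left X P <-> exists A, A < X /\ forall x, A < x < X -> P x.
Proof.
  split.
  - intros [e He]. exists (X - e). pose proof (cond_pos e). split; [lra|].
    intros x Hx. apply He; [|lra].
    unfold ball; simpl; unfold AbsRing_ball, abs, minus, plus, opp; simpl.
    rewrite Rabs_left; lra.
  - intros [A [HA HP]]. assert (He : 0 < X - A) by lra.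
    exists (mkposreal _ He). intros x Hx Hlt. apply HP. split; [|exact Hlt].
    unfold ball in Hx; simpl in Hx; unfold AbsRing_ball, abs, minus, plus, opp in Hx; simpl in Hx.
    rewrite Rabs_left in Hx; lra.
Qed.

Lemma filterlim_real_iff {T : Type} {G : (T -> Prop) -> Prop} {FG : Filter G}
    (f : T -> R) (l : R) :
  filterlim f G (locally l) <-> forall e, 0 < e -> G (fun x => l - e < f x < l + e).
Proof.
  rewrite (filterlim_locally f l). split.
  - intros H e He. generalize (H (mkposreal e He)). apply filter_imp. intros x Hx.
    apply Rabs_def2 in Hx. unfold minus, plus, opp in Hx; simpl in Hx. lra.
  - intros H e. generalize (H e (cond_pos e)). apply filter_imp. intros x Hx.
    apply Rabs_def1; unfold minus, plus, opp; simpl; lra.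
Qed.

Lemma filterlim_eventually_gt {T : Type} {G : (T -> Prop) -> Prop} {FG : Filter G}
    (f : T -> R) (l c : R) :
  filterlim f G (locally l) -> c < l -> G (fun x => c < f x).
Proof.
  intros H Hc. assert (He : 0 < l - c) by lra.
  generalize (proj1 (filterlim_real_iff f l) H _ He). apply filter_imp.
  intros x; lra.
Qed.

Lemma filterlim_eventually_lt {T : Type} {G : (T -> Prop) -> Prop} {FG : Filter G}
    (f : T -> R) (l c : R) :
  filterlim f G (locally l) -> l < c -> G (fun x => f x < c).
Proof.
  intros H Hc. assert (He : 0 < c - l) by lra.
  generalize (proj1 (filterlim_real_iff f l) H _ He). apply filter_imp.
  intros x; lra.
Qed.

Lemma filterlim_Rplus {T : Type} {G : (T -> Prop) -> Prop} {FG : Filter G}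
    (f g : T -> R) (lf lg : R) :
  filterlim f G (locally lf) -> filterlim g G (locally lg) ->
  filterlim (fun x => f x + g x) G (locally (lf + lg)).
Proof.
  intros Hf Hg. eapply filterlim_comp_2; [exact Hf | exact Hg |].
  exact (filterlim_plus lf lg).
Qed.

Lemma filterlim_Rmult {T : Type} {G : (T -> Prop) -> Prop} {FG : Filter G}
    (f g : T -> R) (lf lg : R) :
  filterlim f G (locally lf) -> filterlim g G (locally lg) ->
  filterlim (fun x => f x * g x) G (locally (lf * lg)).
Proof.
  intros Hf Hg. eapply filterlim_comp_2; [exact Hf | exact Hg |].
  exact (filterlim_mult (K := R_AbsRing) lf lg).
Qed.

Lemma filterlim_scal_R {T : Type} {G : (T -> Prop) -> Prop} {FG : Filter G}
    (c : R) (f : T -> R) (l : R) :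
  filterlim f G (locally l) -> filterlim (fun x => c * f x) G (locally (c * l)).
Proof. intros Hf. apply filterlim_Rmult; [apply filterlim_const | exact Hf]. Qed.

Lemma filterlim_at_left_continuous (f : R -> R) (X : R) :
  continuous f X -> filterlim f (at_left X) (locally (f X)).
Proof.
  intros H. eapply filterlim_filter_le_1; [|exact H]. apply filter_le_within.
Qed.

(** * Real powers of positive functions *)

Lemma Rpower_pos (x e : R) : 0 < Rpower x e.
Proof. apply exp_pos. Qed.

Lemma is_derive_Rpower_comp (f : R -> R) (x l e : R) :
  0 < f x -> is_derive f x l ->
  is_derive (fun y => Rpower (f y) e) x (e * Rpower (f x) (e - 1) * l).
Proof.
  intros Hp Hf.
  replace (e * Rpower (f x) (e - 1) * l) with (scal l (e * Rpower (f x) (e - 1)))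
    by (unfold scal; simpl; unfold mult; simpl; ring).
  apply (is_derive_comp (fun t => Rpower t e) f); [|exact Hf].
  apply is_derive_Reals, derivable_pt_lim_power, Hp.
Qed.

Lemma continuous_is_derive (f : R -> R) (x l : R) : is_derive f x l -> continuous f x.
Proof. intros H. apply (ex_derive_continuous (V := R_NormedModule)). exists l. exact H. Qed.

Lemma continuous_Rpower (x e : R) : 0 < x -> continuous (fun t => Rpower t e) x.
Proof.
  intros Hx. apply (continuous_is_derive _ _ (e * Rpower x (e - 1))).
  apply is_derive_Reals, derivable_pt_lim_power, Hx.
Qed.

Lemma Rpower_lt_l (e x y : R) : 0 < e -> 0 < x < y -> Rpower x e < Rpower y e.
Proof.
  intros He Hx. apply exp_increasing, Rmult_lt_compat_l; [exact He|].
  apply ln_increasing; lra.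
Qed.

Lemma Rpower_le_l (e x y : R) : 0 <= e -> 0 < x <= y -> Rpower x e <= Rpower y e.
Proof. intros He Hx. apply Rle_Rpower_l; lra. Qed.

(** Positivity along the filter is assumed because [Rpower 0 e = 1]: the power is not continuous at
    0 and cannot simply be composed with the limit of [f]. *)
Lemma filterlim_Rpower_0 {T : Type} {G : (T -> Prop) -> Prop} {FG : Filter G}
    (f : T -> R) (e : R) :
  0 < e -> G (fun x => 0 < f x) -> filterlim f G (locally 0) ->
  filterlim (fun x => Rpower (f x) e) G (locally 0).
Proof.
  intros He Hp Hf. apply filterlim_real_iff. intros d Hd.
  generalize (filter_and _ _ Hp (filterlim_eventually_lt f 0 (Rpower d (/ e)) Hf (Rpower_pos _ _))).
  apply filter_imp. intros x [H1 H2].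
  pose proof (Rpower_pos (f x) e). split; [lra|].
  replace (0 + d) with (Rpower (Rpower d (/ e)) e).
  - apply Rpower_lt_l; lra.
  - rewrite Rpower_mult, Rinv_l, Rpower_1; lra.
Qed.

(** * Mean value arguments and one-sided barriers *)

Lemma mean_value (f f' : R -> R) (a b : R) :
  a < b -> (forall x, a <= x <= b -> is_derive f x (f' x)) ->
  exists c, a < c < b /\ f b - f a = f' c * (b - a).
Proof.
  intros Hab Hd. destruct (MVT_cor2 f f' a b Hab) as [c [H1 H2]].
  - intros c Hc. apply is_derive_Reals, Hd, Hc.
  - exists c. tauto.
Qed.

(* The minimum of [Q] over [[a, x]] can only be attained at [x]. *)
Lemma barrier_decreasing (Q Q' : R -> R) (a x : R) :
  (forall y, a <= y <= x -> is_derive Q y (Q' y)) ->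
  (forall y, a <= y <= x -> Q y <= 0 -> Q' y < 0) ->
  a < x -> Q a <= 0 -> Q x < Q a.
Proof.
  intros Hd Hneg Hax Ha.
  destruct (continuity_ab_min Q a x) as [p [Hmin Hp]]; [lra| |].
  { intros c Hc. apply derivable_continuous_pt. exists (Q' c).
    apply is_derive_Reals, Hd, Hc. }
  assert (Hstep : forall y, a <= y < x -> Q y <= 0 -> exists z, y < z < x /\ Q z < Q y).
  { intros y Hy Hy0.
    assert (Hy' : Q' y < 0) by (apply Hneg; lra).
    assert (Hdy : derivable_pt_lim Q y (Q' y)) by (apply is_derive_Reals, Hd; lra).
    destruct (Hdy (- Q' y)) as [d Hdd]; [lra|].
    pose proof (cond_pos d).
    set (k := Rmin (d / 2) ((x - y) / 2)).
    assert (Hk : 0 < k /\ k <= d / 2 /\ k <= (x - y) / 2).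
    { unfold k. repeat split; [apply Rmin_pos; lra | apply Rmin_l | apply Rmin_r]. }
    exists (y + k). split; [lra|].
    specialize (Hdd k). rewrite (Rabs_pos_eq k) in Hdd by lra.
    assert (Hq : Rabs ((Q (y + k) - Q y) / k - Q' y) < - Q' y) by (apply Hdd; lra).
    apply Rabs_def2 in Hq.
    assert (Hq' : (Q (y + k) - Q y) / k < 0) by lra.
    replace (Q (y + k)) with (Q y + (Q (y + k) - Q y) / k * k) by (field; lra).
    nra. }
  (* The minimizer [p] satisfies [Q p <= Q a <= 0], so [Hstep] applies to it unless [p = x]; applied
     at [a], it makes the final inequality strict. *)
  assert (Hpa : Q p <= Q a) by (apply Hmin; lra).
  destruct (Hstep a) as [z [Hz Hza]]; [lra|lra|].
  assert (Hpz : Q p <= Q z) by (apply Hmin; lra).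
  destruct (Req_dec p x) as [->|Hpx]; [lra|].
  destruct (Hstep p) as [w [Hw Hwp]]; [lra|lra|].
  assert (Q p <= Q w) by (apply Hmin; lra). lra.
Qed.

(* Once [Q <= 0], [Q] stays below a negative value and cannot tend to [0]. *)
Lemma barrier_positive (Q Q' : R -> R) (A X : R) :
  (forall x, A < x < X -> is_derive Q x (Q' x)) ->
  filterlim Q (at_left X) (locally 0) ->
  (forall x, A < x < X -> Q x <= 0 -> Q' x < 0) ->
  forall x, A < x < X -> 0 < Q x.
Proof.
  intros Hd Hlim Hneg x Hx. apply Rnot_le_lt. intros Hle.
  set (y := (x + X) / 2).
  assert (Hy : Q y < Q x).
  { apply (barrier_decreasing Q Q'); try (unfold y; lra).
    - intros z Hz. apply Hd. unfold y in Hz; lra.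
    - intros z Hz. apply Hneg. unfold y in Hz; lra. }
  assert (Hyx : x < y < X) by (unfold y; lra).
  assert (Hev : at_left X (fun t => Q y < Q t)).
  { apply (filterlim_eventually_gt Q 0); [exact Hlim|lra]. }
  apply at_left_iff in Hev. destruct Hev as [B [HB Hev]].
  (* This [t] lies beyond [y] and close enough to [X] for the limit 0 to force [Q t > Q y], whereas
     the barrier on the interval from [y] to [t] gives [Q t < Q y]. *)
  set (t := (Rmax B y + X) / 2).
  pose proof (Rmax_l B y). pose proof (Rmax_r B y).
  assert (Rmax B y < X) by (apply Rmax_lub_lt; lra).
  assert (Ht : Q y < Q t) by (apply Hev; unfold t; lra).
  assert (Q t < Q y); [|lra].
  apply (barrier_decreasing Q Q'); try (unfold t; lra).
  - intros z Hz. apply Hd. unfold t in Hz; lra.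
  - intros z Hz. apply Hneg. unfold t in Hz; lra.
Qed.

Lemma not_positive_of_derive_le (u u' : R -> R) (A d : R) :
  0 < d -> (forall x, A <= x -> is_derive u x (u' x)) ->
  (forall x, A <= x -> u' x <= - d) -> ~ (forall x, A <= x -> 0 < u x).
Proof.
  intros Hd Hu Hu' Hpos.
  (* At [B], a decay at rate [d] has used up the whole initial value [u A]. *)
  set (B := A + u A / d).
  assert (HuA : 0 < u A) by (apply Hpos; lra).
  assert (0 < u A / d) by (apply Rdiv_lt_0_compat; lra).
  destruct (mean_value u u' A B) as [c [Hc Hm]]; [unfold B; lra| |].
  { intros x Hx. apply Hu; lra. }
  assert (u' c <= - d) by (apply Hu'; lra).
  assert (0 < u B) by (apply Hpos; unfold B; lra).
  assert (d * (B - A) = u A) by (unfold B; field; lra). nra.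
Qed.

Lemma at_left_limit_increasing (U : R -> R) (A X M : R) :
  A < X -> (forall x y, A < x -> x <= y -> y < X -> U x <= U y) ->
  (forall x, A < x < X -> U x <= M) ->
  exists l, filterlim U (at_left X) (locally l).
Proof.
  intros HAX Hmon HM.
  destruct (completeness (fun v => exists x, A < x < X /\ v = U x)) as [l [Hub Hlub]].
  - exists M. intros v [x [Hx ->]]. apply HM, Hx.
  - exists (U ((A + X) / 2)), ((A + X) / 2). split; [lra|reflexivity].
  - exists l. apply filterlim_real_iff. intros e He.
    destruct (classic (exists x, A < x < X /\ l - e < U x)) as [[x [Hx HUx]]|Hn].
    + apply at_left_iff. exists x. split; [lra|]. intros y Hy.
      assert (U x <= U y) by (apply Hmon; lra).
      assert (U y <= l) by (apply Hub; exists y; split; [lra|reflexivity]). lra.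
    + exfalso. assert (l <= l - e); [|lra]. apply Hlub. intros v [x [Hx ->]].
      apply Rnot_lt_le. intros Hlt. apply Hn. exists x. split; assumption.
Qed.

(** A one-sided l'Hospital rule: the mean value theorem between [x] and [y < X] traps [g y] between
    two lines through [(x, g x)], and then [y] tends to [X]. Nothing is required of [g] at [X]
    itself. *)
Lemma at_left_quotient (g g' : R -> R) (A X l : R) :
  A < X -> (forall x, A < x < X -> is_derive g x (g' x)) ->
  filterlim g (at_left X) (locally 0) -> filterlim g' (at_left X) (locally l) ->
  filterlim (fun x => g x / (X - x)) (at_left X) (locally (- l)).
Proof.
  intros HAX Hd Hg Hg'. apply filterlim_real_iff. intros e He.
  assert (He2 : 0 < e / 2) by lra.
  pose proof (proj1 (filterlim_real_iff g' l) Hg' _ He2) as H.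
  apply at_left_iff in H. destruct H as [B [HB H]].
  apply at_left_iff. exists (Rmax A B). split; [apply Rmax_lub_lt; lra|].
  intros x Hx. pose proof (Rmax_l A B). pose proof (Rmax_r A B).
  assert (Hc : forall y, x < y < X ->
            (l - e / 2) * (y - x) + g x <= g y <= (l + e / 2) * (y - x) + g x).
  { intros y Hy. destruct (mean_value g g' x y) as [c [Hc Hm]]; [lra| |].
    - intros z Hz. apply Hd; lra.
    - assert (l - e / 2 < g' c < l + e / 2) by (apply H; lra). split; nra. }
  assert (Hlin : forall k, filterlim (fun y => k * (y - x) + g x) (at_left X)
                             (locally (k * (X - x) + g x))).
  { intros k. apply (filterlim_at_left_continuous (fun y => k * (y - x) + g x)).
    apply (continuous_is_derive _ _ k). auto_derive; [trivial|ring]. }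
  assert (Hev : at_left X (fun y => x < y < X)).
  { apply at_left_iff. exists x. split; [lra|trivial]. }
  assert (Hlo : (l - e / 2) * (X - x) + g x <= 0).
  { apply (filterlim_le (F := at_left X)
             (fun y => (l - e / 2) * (y - x) + g x) g
             (Finite ((l - e / 2) * (X - x) + g x)) (Finite 0)); [|apply Hlin|exact Hg].
    revert Hev. apply filter_imp. intros y Hy. apply Hc, Hy. }
  assert (Hhi : 0 <= (l + e / 2) * (X - x) + g x).
  { apply (filterlim_le (F := at_left X) g
             (fun y => (l + e / 2) * (y - x) + g x) (Finite 0)
             (Finite ((l + e / 2) * (X - x) + g x))); [|exact Hg|apply Hlin].
    revert Hev. apply filter_imp. intros y Hy. apply Hc, Hy. }
  set (r := g x / (X - x)).
  assert (Hr : g x = r * (X - x)) by (unfold r; field; lra).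
  rewrite Hr in Hlo, Hhi. split; nra.
Qed.

(** * Phase-plane comparison *)

(** The equation with [n] for $N-1$, explicit first and second derivatives, and the derivative of
    $F^{1/m}$ expanded by the chain rule, so that the comparison is algebra in [F], [F1], [F2]. *)
Record decreasing_solution (n al be m q s : R) (F F1 F2 : R -> R) (xm : Rbar) : Prop := {
  dsol_derive : forall x : R, 0 < x -> Rbar_lt x xm -> is_derive F x (F1 x);
  dsol_derive1 : forall x : R, 0 < x -> Rbar_lt x xm -> is_derive F1 x (F2 x);
  dsol_pos : forall x : R, 0 < x -> Rbar_lt x xm -> 0 < F x;
  dsol_neg : forall x : R, 0 < x -> Rbar_lt x xm -> F1 x < 0;
  dsol_ode : forall x : R, 0 < x -> Rbar_lt x xm ->
    F2 x + n / x * F1 x + al * Rpower (F x) (1 / m)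
    - be * x * (1 / m * Rpower (F x) (1 / m - 1) * F1 x)
    - Rpower x s * Rpower (F x) (q / m) = 0
}.

(** The coefficient of [F1] once the equation is solved for [F2]. *)
Definition drift (n be m : R) (F : R -> R) (x : R) : R :=
  be / m * x * Rpower (F x) (1 / m - 1) - n / x.

(* The sign of [energy k] tells on which side of the curve
   [- F' = k F^((m+q)/(2m))] the solution lies; on the curve itself, the
   derivative of [energy k] is [2 (-F') F^(q/m) defect k]. *)
Definition energy (m q k : R) (F F1 : R -> R) (x : R) : R :=
  F1 x ^ 2 - k ^ 2 * Rpower (F x) ((m + q) / m).

(** On the curve $F'=-kF^{(m+q)/(2m)}$, motion along the curve would give
    $F''=\frac{m+q}{2m}k^2F^{q/m}$. The defect is the excess of this over the $F''$ dictated by the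
    equation, divided by $F^{q/m}$. *)
Definition defect (n al be m q s k : R) (F : R -> R) (x : R) : R :=
  al * Rpower (F x) ((1 - q) / m)
  + k * (be / m * (x * Rpower (F x) ((2 - m - q) / (2 * m))))
  - k * (n / x * Rpower (F x) ((m - q) / (2 * m)))
  - Rpower x s + (m + q) / (2 * m) * k ^ 2.

Definition energy' (n al be m q s k : R) (F F1 : R -> R) (x : R) : R :=
  2 * F1 x * (- (Rpower (F x) (q / m) * defect n al be m q s k F x)
    + (F1 x + k * Rpower (F x) ((m + q) / (2 * m))) * drift n be m F x).

Lemma Rpower_half_sq (m q y : R) : 0 < m ->
  Rpower y ((m + q) / m) = Rpower y ((m + q) / (2 * m)) ^ 2.
Proof.
  intros Hm. simpl. rewrite Rmult_1_r, <- Rpower_plus. f_equal. field. lra.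
Qed.

(** Here [k] is arbitrary: the multiple of [drift] added to [F1 * drift] cancels the terms of
    [defect] that are linear in [k]. The rest is matching powers of [F]. *)
Lemma second_derivative_defect n al be m q s F F1 F2 xm
    (H : decreasing_solution n al be m q s F F1 F2 xm) (k x : R) :
  0 < m -> 0 < x -> Rbar_lt x xm ->
  F2 x = (m + q) / (2 * m) * k ^ 2 * Rpower (F x) (q / m)
    - Rpower (F x) (q / m) * defect n al be m q s k F x
    + (F1 x + k * Rpower (F x) ((m + q) / (2 * m))) * drift n be m F x.
Proof.
  intros Hm Hx Hxm.
  pose proof (dsol_ode _ _ _ _ _ _ _ _ _ _ H x Hx Hxm) as Hode.
  unfold defect, drift.
  assert (E1 : Rpower (F x) (1 / m) = Rpower (F x) (q / m) * Rpower (F x) ((1 - q) / m)).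
  { rewrite <- Rpower_plus. f_equal. field. lra. }
  assert (E2 : Rpower (F x) (q / m) * Rpower (F x) ((2 - m - q) / (2 * m))
             = Rpower (F x) (1 / m - 1) * Rpower (F x) ((m + q) / (2 * m))).
  { rewrite <- !Rpower_plus. f_equal. field. lra. }
  assert (E3 : Rpower (F x) (q / m) * Rpower (F x) ((m - q) / (2 * m))
             = Rpower (F x) ((m + q) / (2 * m))).
  { rewrite <- !Rpower_plus. f_equal. field. lra. }
  rewrite E1 in Hode.
  (* Multiplying the power identities by their coefficients beforehand leaves a goal that is linear
     in its monomials. *)
  apply (f_equal (fun z => k * (be / m) * x * z)) in E2.
  apply (f_equal (fun z => k * (n / x) * z)) in E3.
  unfold Rdiv in *. rewrite Rinv_mult in *. lra.
Qed.

Lemma is_derive_energy n al be m q s F F1 F2 xm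
    (H : decreasing_solution n al be m q s F F1 F2 xm) (k x : R) :
  0 < m -> 0 < x -> Rbar_lt x xm ->
  is_derive (energy m q k F F1) x (energy' n al be m q s k F F1 x).
Proof.
  intros Hm Hx Hxm.
  pose proof (dsol_derive _ _ _ _ _ _ _ _ _ _ H x Hx Hxm) as D0.
  pose proof (dsol_derive1 _ _ _ _ _ _ _ _ _ _ H x Hx Hxm) as D1.
  pose proof (dsol_pos _ _ _ _ _ _ _ _ _ _ H x Hx Hxm) as Hp.
  pose proof (second_derivative_defect _ _ _ _ _ _ _ _ _ _ H k x Hm Hx Hxm) as HF2.
  pose proof (is_derive_Rpower_comp F x (F1 x) ((m + q) / m) Hp D0) as DR.
  replace (energy' n al be m q s k F F1 x) with
    (INR 2 * F2 x * F1 x ^ 1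
     - k ^ 2 * ((m + q) / m * Rpower (F x) ((m + q) / m - 1) * F1 x)).
  - apply (is_derive_minus (fun y => F1 y ^ 2)
             (fun y => k ^ 2 * Rpower (F y) ((m + q) / m))).
    + apply is_derive_pow, D1.
    + apply (is_derive_scal (fun y => Rpower (F y) ((m + q) / m)) x (k ^ 2)), DR.
  - replace ((m + q) / m - 1) with (q / m) by (field; lra).
    unfold energy'. rewrite HF2. simpl. field. lra.
Qed.

(** The energy is a difference of squares, and its factor $F'-kF^{(m+q)/(2m)}$ is negative, so the
    other factor has the opposite sign to the energy. *)
Lemma energy_nonpos m q k (F F1 : R -> R) (x : R) : 0 < m -> 0 <= k -> F1 x < 0 ->
  energy m q k F F1 x <= 0 -> 0 <= F1 x + k * Rpower (F x) ((m + q) / (2 * m)).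
Proof.
  unfold energy. intros Hm Hk HF1 HE. rewrite Rpower_half_sq in HE by exact Hm.
  pose proof (Rpower_pos (F x) ((m + q) / (2 * m))).
  set (u := Rpower (F x) ((m + q) / (2 * m))) in *.
  apply Rnot_lt_le. intros Hlt. assert (0 <= k * u) by nra. nra.
Qed.

Lemma energy_nonneg m q k (F F1 : R -> R) (x : R) : 0 < m -> 0 <= k -> F1 x < 0 ->
  0 <= energy m q k F F1 x -> F1 x + k * Rpower (F x) ((m + q) / (2 * m)) <= 0.
Proof.
  unfold energy. intros Hm Hk HF1 HE. rewrite Rpower_half_sq in HE by exact Hm.
  pose proof (Rpower_pos (F x) ((m + q) / (2 * m))).
  set (u := Rpower (F x) ((m + q) / (2 * m))) in *.
  apply Rnot_lt_le. intros Hlt. assert (0 <= k * u) by nra. nra.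
Qed.

(** Off the curve, the [drift] term has the same sign as the [defect] term, so the sign found on the
    curve persists on the whole side [energy <= 0]. The next lemma is the mirror image. *)
Lemma energy'_neg n al be m q s k (F F1 : R -> R) (x : R) : 0 < m -> 0 <= k ->
  F1 x < 0 -> 0 <= drift n be m F x -> defect n al be m q s k F x < 0 ->
  energy m q k F F1 x <= 0 -> energy' n al be m q s k F F1 x < 0.
Proof.
  intros Hm Hk HF1 Hc Hd HE.
  pose proof (energy_nonpos m q k F F1 x Hm Hk HF1 HE) as Hu.
  pose proof (Rpower_pos (F x) (q / m)).
  pose proof (Rmult_le_pos _ _ Hu Hc).
  assert (Rpower (F x) (q / m) * defect n al be m q s k F x < 0) by nra.
  unfold energy'. nra.
Qed.

Lemma energy'_pos n al be m q s k (F F1 : R -> R) (x : R) : 0 < m -> 0 <= k ->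
  F1 x < 0 -> 0 <= drift n be m F x -> 0 < defect n al be m q s k F x ->
  0 <= energy m q k F F1 x -> 0 < energy' n al be m q s k F F1 x.
Proof.
  intros Hm Hk HF1 Hc Hd HE.
  pose proof (energy_nonneg m q k F F1 x Hm Hk HF1 HE) as Hu.
  pose proof (Rpower_pos (F x) (q / m)).
  assert (0 < Rpower (F x) (q / m) * defect n al be m q s k F x) by nra.
  set (u := F1 x + k * Rpower (F x) ((m + q) / (2 * m))) in *.
  assert (u * drift n be m F x <= 0) by nra.
  unfold energy'. fold u. nra.
Qed.

(** * Finite-time extinction and the limit of the derivative there *)

Lemma decreasing_solution_antitone n al be m q s F F1 F2 xm
    (H : decreasing_solution n al be m q s F F1 F2 xm) (x y : R) :
  0 < x -> x <= y -> Rbar_lt y xm -> F y <= F x.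
Proof.
  intros Hx Hxy Hy. destruct (Req_dec x y) as [->|Hne]; [lra|].
  assert (Hlt : forall z : R, z <= y -> Rbar_lt z xm).
  { intros z Hz. eapply Rbar_le_lt_trans; [|exact Hy]. exact Hz. }
  destruct (mean_value F F1 x y) as [c [Hc Hm]]; [lra| |].
  - intros z Hz. apply (dsol_derive _ _ _ _ _ _ _ _ _ _ H); [lra|apply Hlt; lra].
  - assert (F1 c < 0); [|nra].
    apply (dsol_neg _ _ _ _ _ _ _ _ _ _ H); [lra|apply Hlt; lra].
Qed.

(* Since [s > 2], the absorption eventually beats every other term, and forces
   either [- F' > F^((m+q)/(2m))] or [F'' > c > 0]: [F] vanishes in finite time in
   the former case, [F'] in the latter. *)
Lemma no_global_decreasing_solution n al be m q s F F1 F2 :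
  0 <= n -> 0 < al -> 0 < be -> 1 < m -> 0 < q < 1 -> m + q <= 2 -> 2 < s ->
  ~ decreasing_solution n al be m q s F F1 F2 p_infty.
Proof.
  intros Hn Hal Hbe Hm Hq Hmq Hs H.
  assert (Hd : forall x, 0 < x -> is_derive F x (F1 x))
    by (intros; apply (dsol_derive _ _ _ _ _ _ _ _ _ _ H); simpl; trivial).
  assert (Hd1 : forall x, 0 < x -> is_derive F1 x (F2 x))
    by (intros; apply (dsol_derive1 _ _ _ _ _ _ _ _ _ _ H); simpl; trivial).
  assert (Hpos : forall x, 0 < x -> 0 < F x)
    by (intros; apply (dsol_pos _ _ _ _ _ _ _ _ _ _ H); simpl; trivial).
  assert (Hneg : forall x, 0 < x -> F1 x < 0)
    by (intros; apply (dsol_neg _ _ _ _ _ _ _ _ _ _ H); simpl; trivial).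
  assert (Hle : forall x, 1 <= x -> F x <= F 1).
  { intros x Hx. apply (decreasing_solution_antitone _ _ _ _ _ _ _ _ _ _ H); simpl; lra. }
  assert (Hpow : forall e x, 0 <= e -> 1 <= x -> Rpower (F x) e <= Rpower (F 1) e).
  { intros e x He Hx. apply Rpower_le_l; [exact He|]. split; [apply Hpos; lra|apply Hle, Hx]. }
  assert (Hinv : forall e, 0 <= e -> 0 <= e / m) by (intros; apply Rdiv_le_0_compat; lra).
  (* As $1/m-1<0$ and [F x <= F 1], the first term of [drift] is at least [c * x], while
     [n / x <= n]. *)
  assert (Hdrift : exists A, 1 <= A /\ forall x, A <= x -> 0 <= drift n be m F x).
  { set (c := be / m * Rpower (F 1) (1 / m - 1)).
    assert (Hc : 0 < c).
    { apply Rmult_lt_0_compat; [apply Rdiv_lt_0_compat; lra|apply Rpower_pos]. }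
    assert (0 <= n / c) by (apply Rdiv_le_0_compat; lra).
    exists (1 + n / c). split; [lra|]. intros x Hx. unfold drift.
    assert (Hp1 : Rpower (F 1) (1 / m - 1) <= Rpower (F x) (1 / m - 1)).
    { replace (1 / m - 1) with (- ((m - 1) / m)) by (field; lra).
      rewrite !Rpower_Ropp. apply Rinv_le_contravar; [apply Rpower_pos|].
      apply Hpow; [apply Hinv|]; lra. }
    assert (Hbm : 0 < be / m * x)
      by (apply Rmult_lt_0_compat; [apply Rdiv_lt_0_compat|]; lra).
    assert (Hcx : c * x <= be / m * x * Rpower (F x) (1 / m - 1)) by (unfold c; nra).
    assert (Hnx : n / x <= n).
    { apply Rmult_le_reg_r with x; [lra|].
      replace (n / x * x) with n by (field; lra). nra. }
    assert (n <= c * x); [|lra].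
    replace n with (c * (n / c)) at 1 by (field; lra). apply Rmult_le_compat_l; lra. }
  (* Since $m+q\le2$, the powers of [F] in [defect] have nonnegative exponents and are bounded by
     their values at 1. With [C1], [C2] collecting them, $x\ge 1+C_1+C_2$ gives $x^s\ge x^2\ge
     C_1+C_2x$. *)
  assert (Hdef : exists A, 1 <= A /\ forall x, A <= x -> defect n al be m q s 1 F x <= -1).
  { set (C1 := al * Rpower (F 1) ((1 - q) / m) + (m + q) / (2 * m) + 1).
    set (C2 := be / m * Rpower (F 1) ((2 - m - q) / (2 * m))).
    assert (0 < C1).
    { assert (0 < al * Rpower (F 1) ((1 - q) / m))
        by (apply Rmult_lt_0_compat; [lra|apply Rpower_pos]).
      assert (0 < (m + q) / (2 * m)) by (apply Rdiv_lt_0_compat; lra). unfold C1; lra. }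
    assert (0 < C2).
    { apply Rmult_lt_0_compat; [apply Rdiv_lt_0_compat; lra|apply Rpower_pos]. }
    exists (1 + C1 + C2). split; [lra|]. intros x Hx. unfold defect.
    assert (Hx2 : x ^ 2 <= Rpower x s).
    { rewrite <- (Rpower_pow 2 x) by lra. apply Rle_Rpower; simpl; lra. }
    assert (Ht1 : al * Rpower (F x) ((1 - q) / m) <= al * Rpower (F 1) ((1 - q) / m)).
    { apply Rmult_le_compat_l; [lra|]. apply Hpow; [apply Hinv|]; lra. }
    assert (Ht2 : be / m * (x * Rpower (F x) ((2 - m - q) / (2 * m))) <= C2 * x).
    { unfold C2. rewrite (Rmult_comm x), <- Rmult_assoc.
      apply Rmult_le_compat_r; [lra|]. apply Rmult_le_compat_l; [apply Hinv; lra|].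
      apply Hpow; [apply Rdiv_le_0_compat|]; lra. }
    assert (Ht3 : 0 <= n / x * Rpower (F x) ((m - q) / (2 * m))).
    { apply Rmult_le_pos; [apply Rdiv_le_0_compat; lra|apply Rlt_le, Rpower_pos]. }
    assert (C1 + C2 * x <= x ^ 2) by nra.
    unfold C1 in *. lra. }
  destruct Hdrift as [A1 [HA1 Hdrift]]. destruct Hdef as [A2 [HA2 Hdef]].
  set (A := Rmax A1 A2).
  pose proof (Rmax_l A1 A2) as HAl. pose proof (Rmax_r A1 A2) as HAr. fold A in HAl, HAr.
  assert (HdE : forall y, A <= y ->
            is_derive (energy m q 1 F F1) y (energy' n al be m q s 1 F F1 y)).
  { intros y Hy. apply (is_derive_energy _ _ _ _ _ _ _ _ _ _ H); simpl; trivial; lra. }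
  assert (HE' : forall y, A <= y -> energy m q 1 F F1 y <= 0 ->
            energy' n al be m q s 1 F F1 y < 0).
  { intros y Hy HE. assert (defect n al be m q s 1 F y <= -1) by (apply Hdef; lra).
    apply energy'_neg; try lra; [apply Hneg; lra|apply Hdrift; lra]. }
  destruct (classic (exists x, A <= x /\ energy m q 1 F F1 x <= 0))
    as [[x1 [Hx1 HE1]]|Hn1].
  - assert (Hdec : forall x, x1 < x -> energy m q 1 F F1 x < energy m q 1 F F1 x1).
    { intros x Hx. apply (barrier_decreasing _ (energy' n al be m q s 1 F F1)); try lra.
      - intros y Hy. apply HdE; lra.
      - intros y Hy. apply HE'; lra. }
    (* The energy may vanish at [x1]; one unit later it is strictly negative and stays below [- d].
       This bounds [F] from below, hence [F2] too, and [F1] cannot remain negative. *)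
    set (x2 := x1 + 1).
    assert (Hx2 : energy m q 1 F F1 x2 < 0)
      by (specialize (Hdec x2); unfold x2 in *; lra).
    set (d := - energy m q 1 F F1 x2).
    assert (HE : forall x, x2 <= x -> energy m q 1 F F1 x <= - d).
    { intros x Hx. destruct (Req_dec x x2) as [->|Hne]; [unfold d; lra|].
      assert (energy m q 1 F F1 x < energy m q 1 F F1 x2); [|unfold d; lra].
      apply (barrier_decreasing _ (energy' n al be m q s 1 F F1)); try lra.
      - intros y Hy. apply HdE; unfold x2 in *; lra.
      - intros y Hy. apply HE'; unfold x2 in *; lra. }
    assert (Hd0 : 0 < d) by (unfold d; lra).
    apply (not_positive_of_derive_le (fun x => - F1 x) (fun x => - F2 x) x2
             (Rpower d (q / (m + q)))).
    + apply Rpower_pos.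
    + intros x Hx. apply (is_derive_opp F1 x (F2 x)), Hd1. unfold x2 in *; lra.
    + intros x Hx. specialize (HE x Hx).
      assert (Hx0 : 0 < x) by (unfold x2 in *; lra).
      assert (Hxm : Rbar_lt x p_infty) by exact I.
      assert (HF : d <= Rpower (F x) ((m + q) / m)).
      { unfold energy in HE. pose proof (pow2_ge_0 (F1 x)). lra. }
      assert (HFq : Rpower d (q / (m + q)) <= Rpower (F x) (q / m)).
      { replace (q / m) with ((m + q) / m * (q / (m + q))) by (field; lra).
        rewrite <- Rpower_mult. apply Rpower_le_l; [apply Rdiv_le_0_compat; lra|lra]. }
      assert (Hf : defect n al be m q s 1 F x <= -1) by (apply Hdef; unfold x2 in *; lra).
      assert (Hc : 0 <= drift n be m F x) by (apply Hdrift; unfold x2 in *; lra).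
      assert (Hu : 0 <= F1 x + 1 * Rpower (F x) ((m + q) / (2 * m))).
      { apply energy_nonpos; try lra. apply Hneg, Hx0. }
      pose proof (second_derivative_defect _ _ _ _ _ _ _ _ _ _ H 1 x ltac:(lra) Hx0 Hxm)
        as HF2.
      pose proof (Rmult_le_pos _ _ Hu Hc). pose proof (Rpower_pos (F x) (q / m)).
      assert (0 < (m + q) / (2 * m)) by (apply Rdiv_lt_0_compat; lra).
      nra.
    + intros x Hx. assert (F1 x < 0) by (apply Hneg; unfold x2 in *; lra). lra.
  - assert (HE : forall x, A <= x -> 0 < energy m q 1 F F1 x).
    { intros x Hx. apply Rnot_le_lt. intros Hle0. apply Hn1. exists x. tauto. }
    (* With this exponent, $F'\le -F^{(m+q)/(2m)}$ says exactly that $F^e$ has derivative at most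
       $-e$. *)
    set (e := (m - q) / (2 * m)).
    assert (He : 0 < e) by (apply Rdiv_lt_0_compat; lra).
    apply (not_positive_of_derive_le (fun x => Rpower (F x) e)
             (fun x => e * Rpower (F x) (e - 1) * F1 x) A e He).
    + intros x Hx. apply is_derive_Rpower_comp; [apply Hpos|apply Hd]; lra.
    + intros x Hx.
      assert (Hu : F1 x + 1 * Rpower (F x) ((m + q) / (2 * m)) <= 0).
      { apply energy_nonneg; try lra; [apply Hneg; lra|apply Rlt_le, HE, Hx]. }
      assert (Hprod : Rpower (F x) (e - 1) * Rpower (F x) ((m + q) / (2 * m)) = 1).
      { rewrite <- Rpower_plus. unfold e.
        replace ((m - q) / (2 * m) - 1 + (m + q) / (2 * m)) with 0 by (field; lra).
        apply Rpower_O, Hpos; lra. }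
      pose proof (Rpower_pos (F x) (e - 1)).
      assert (Rpower (F x) (e - 1) * F1 x <= - 1) by nra. nra.
    + intros x Hx. apply Rpower_pos.
Qed.

(** The combination $U=F'-\beta xF^{1/m}+Cx$ is monotone: subtracting $\beta xF^{1/m}$ removes the
    possibly singular $F^{1/m-1}F'$, and $C$ dominates the remaining $-(\alpha+\beta)F^{1/m}$. As
    $U\le CX$, it has a limit, and so has $F'$. *)
Lemma derivative_at_extinction n al be m q s F F1 F2 (X : R) :
  0 <= n -> 0 <= al -> 0 <= be -> 0 < m -> 0 < X ->
  decreasing_solution n al be m q s F F1 F2 X ->
  filterlim F (at_left X) (locally 0) ->
  exists l, filterlim F1 (at_left X) (locally l).
Proof.
  intros Hn Hal Hbe Hm HX H HF0.
  set (A := X / 2).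
  set (C := (al + be) * Rpower (F A) (1 / m)).
  set (f := fun x => Rpower (F x) (1 / m)).
  set (U := fun x => F1 x - be * (x * f x) + C * x).
  set (U' := fun x => F2 x - be * (1 * f x + x * (1 / m * Rpower (F x) (1 / m - 1) * F1 x)) + C).
  assert (Him : 0 < 1 / m) by (apply Rdiv_lt_0_compat; lra).
  assert (Hf0 : filterlim f (at_left X) (locally 0)).
  { apply filterlim_Rpower_0; [exact Him| |exact HF0].
    apply at_left_iff. exists 0. split; [lra|]. intros x Hx.
    apply (dsol_pos _ _ _ _ _ _ _ _ _ _ H); simpl; lra. }
  assert (HU : forall x, A < x < X -> is_derive U x (U' x)).
  { intros x Hx. assert (Hx0 : 0 < x) by (unfold A in Hx; lra).
    pose proof (dsol_derive _ _ _ _ _ _ _ _ _ _ H x Hx0 ltac:(simpl; lra)) as D0.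
    pose proof (dsol_derive1 _ _ _ _ _ _ _ _ _ _ H x Hx0 ltac:(simpl; lra)) as D1.
    pose proof (dsol_pos _ _ _ _ _ _ _ _ _ _ H x Hx0 ltac:(simpl; lra)) as Hp.
    apply (is_derive_plus (fun x => F1 x - be * (x * f x)) (fun x => C * x)).
    - apply (is_derive_minus F1 (fun x => be * (x * f x))); [exact D1|].
      apply (is_derive_scal (fun x => x * f x) x be).
      apply (is_derive_mult (fun x => x) f).
      + apply (is_derive_id (K := R_AbsRing)).
      + apply is_derive_Rpower_comp; assumption.
      + intros; apply Rmult_comm.
    - auto_derive; [trivial|ring]. }
  assert (HU' : forall x, A < x < X -> 0 <= U' x).
  { intros x Hx. assert (Hx0 : 0 < x) by (unfold A in Hx; lra).
    pose proof (dsol_ode _ _ _ _ _ _ _ _ _ _ H x Hx0 ltac:(simpl; lra)) as Ho.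
    pose proof (dsol_pos _ _ _ _ _ _ _ _ _ _ H x Hx0 ltac:(simpl; lra)) as Hp.
    pose proof (dsol_neg _ _ _ _ _ _ _ _ _ _ H x Hx0 ltac:(simpl; lra)) as Hneg.
    assert (Hanti : F x <= F A).
    { apply (decreasing_solution_antitone _ _ _ _ _ _ _ _ _ _ H);
        unfold A in *; simpl; lra. }
    assert (Hfx : (al + be) * f x <= C).
    { apply Rmult_le_compat_l; [lra|]. apply Rpower_le_l; lra. }
    assert (0 <= n / x) by (apply Rdiv_le_0_compat; lra).
    pose proof (Rmult_lt_0_compat _ _ (Rpower_pos x s) (Rpower_pos (F x) (q / m))).
    unfold U', f in *. nra. }
  destruct (at_left_limit_increasing U A X (C * X)) as [l Hl].
  - unfold A; lra.
  - intros x y Hx Hxy Hy. destruct (Req_dec x y) as [->|Hne]; [lra|].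
    destruct (mean_value U U' x y) as [c [Hc Hmv]]; [lra| |].
    + intros z Hz. apply HU; lra.
    + assert (0 <= U' c) by (apply HU'; lra). nra.
  - intros x Hx. assert (Hx0 : 0 < x) by (unfold A in Hx; lra).
    pose proof (dsol_neg _ _ _ _ _ _ _ _ _ _ H x Hx0 ltac:(simpl; lra)) as Hneg.
    assert (0 <= be * (x * f x)).
    { apply Rmult_le_pos; [lra|]. apply Rmult_le_pos; [lra|apply Rlt_le, Rpower_pos]. }
    assert (0 <= C) by (apply Rmult_le_pos; [lra|apply Rlt_le, Rpower_pos]).
    unfold U. nra.
  - exists (l + be * (X * 0) + - C * X).
    assert (Hid : filterlim (fun x : R => x) (at_left X) (locally X))
      by apply (filterlim_at_left_continuous (fun x => x)), continuous_id.
    apply (filterlim_ext (fun x => U x + be * (x * f x) + - C * x)).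
    { intros x. unfold U. ring. }
    apply filterlim_Rplus; [apply filterlim_Rplus; [exact Hl|]|].
    + apply filterlim_scal_R, filterlim_Rmult; assumption.
    + apply filterlim_scal_R, Hid.
Qed.

(* [w] is the limit of [x F^((2-m-q)/(2m))], which vanishes unless [m + q = 2]. *)
Lemma extinction_rate n al be m q s F F1 F2 (X w Y : R) :
  0 < be -> 1 < m -> 0 < q < 1 -> 0 < X ->
  decreasing_solution n al be m q s F F1 F2 X ->
  filterlim F (at_left X) (locally 0) ->
  filterlim F1 (at_left X) (locally 0) ->
  filterlim (fun x => x * Rpower (F x) ((2 - m - q) / (2 * m))) (at_left X) (locally w) ->
  0 <= w -> 0 < Y -> (m + q) / (2 * m) * Y ^ 2 + be / m * w * Y = Rpower X s ->
  left_expansion (profile m F) X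
    (Rpower ((m - q) / (2 * m) * Y) (2 / (m - q))) (2 / (m - q)).
Proof.
  intros Hbe Hm Hq HX H HF0 HF10 Hw Hw0 HY HYeq.
  assert (Hin : at_left X (fun x => 0 < x < X))
    by (apply at_left_iff; exists 0; split; [lra|trivial]).
  assert (HposX : at_left X (fun x => 0 < F x)).
  { revert Hin. apply filter_imp. intros x Hx.
    apply (dsol_pos _ _ _ _ _ _ _ _ _ _ H); simpl; lra. }
  assert (Hid : filterlim (fun x : R => x) (at_left X) (locally X))
    by apply (filterlim_at_left_continuous (fun x => x)), continuous_id.
  assert (Hinv : filterlim (fun x : R => n / x) (at_left X) (locally (n / X))).
  { apply (filterlim_at_left_continuous (fun x => n / x)).
    apply (continuous_is_derive _ _ (- n / X ^ 2)).
    auto_derive; [lra|field; lra]. }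
  assert (HxS : filterlim (fun x : R => Rpower x s) (at_left X) (locally (Rpower X s)))
    by apply (filterlim_at_left_continuous (fun x => Rpower x s)), continuous_Rpower, HX.
  assert (Hbm : 0 < be / m) by (apply Rdiv_lt_0_compat; lra).
  assert (Hth : 0 < (m + q) / (2 * m)) by (apply Rdiv_lt_0_compat; lra).
  assert (HF0e : forall e, 0 < e ->
            filterlim (fun x => Rpower (F x) e) (at_left X) (locally 0))
    by (intros e He; apply filterlim_Rpower_0; assumption).
  (* Multiplied by $F^{(m-1)/m}$, [drift] converges to $\beta X/m>0$. *)
  assert (Hdrift : at_left X (fun x => 0 <= drift n be m F x)).
  { assert (Hlim : filterlim (fun x => be / m * x + - (n / x * Rpower (F x) ((m - 1) / m)))
                     (at_left X) (locally (be / m * X + - (n / X * 0)))).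
    { apply filterlim_Rplus; [apply filterlim_scal_R, Hid|].
      apply (filterlim_comp _ _ _ _ Ropp _ _ _ (filterlim_Rmult _ _ _ _ Hinv
               (HF0e ((m - 1) / m) ltac:(apply Rdiv_lt_0_compat; lra)))).
      exact (filterlim_opp (n / X * 0)). }
    assert (Hp : 0 < be / m * X + - (n / X * 0)) by nra.
    generalize (filter_and _ _ (filterlim_eventually_gt _ _ _ Hlim Hp)
      (filter_and _ _ Hin HposX)).
    apply filter_imp. intros x [Hx1 [Hx2 Hx3]]. unfold drift.
    assert (E : Rpower (F x) (1 / m - 1) * Rpower (F x) ((m - 1) / m) = 1).
    { rewrite <- Rpower_plus. replace (1 / m - 1 + (m - 1) / m) with 0 by (field; lra).
      apply Rpower_O, Hx3. }
    pose proof (Rpower_pos (F x) (1 / m - 1)).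
    replace (n / x) with (n / x * (Rpower (F x) (1 / m - 1) * Rpower (F x) ((m - 1) / m)))
      by (rewrite E; ring).
    nra. }
  assert (Hdefect : forall k, filterlim (defect n al be m q s k F) (at_left X)
            (locally ((m + q) / (2 * m) * k ^ 2 + be / m * w * k - Rpower X s))).
  { intros k. unfold defect, Rminus.
    replace ((m + q) / (2 * m) * k ^ 2 + be / m * w * k + - Rpower X s) with
      (al * 0 + k * (be / m * w) + - k * (n / X * 0) + - 1 * Rpower X s
       + (m + q) / (2 * m) * k ^ 2) by ring.
    apply (filterlim_ext (fun x => al * Rpower (F x) ((1 - q) / m)
      + k * (be / m * (x * Rpower (F x) ((2 - m - q) / (2 * m))))
      + - k * (n / x * Rpower (F x) ((m - q) / (2 * m)))
      + - 1 * Rpower x s + (m + q) / (2 * m) * k ^ 2)).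
    { intros x. unfold Rminus. ring. }
    repeat apply filterlim_Rplus.
    - apply filterlim_scal_R, HF0e, Rdiv_lt_0_compat; lra.
    - apply filterlim_scal_R, filterlim_scal_R, Hw.
    - apply filterlim_scal_R, filterlim_Rmult; [exact Hinv|].
      apply HF0e, Rdiv_lt_0_compat; lra.
    - apply filterlim_scal_R, HxS.
    - apply filterlim_const. }
  assert (HE0 : forall k, filterlim (energy m q k F F1) (at_left X) (locally 0)).
  { intros k. unfold energy.
    apply (filterlim_ext (fun x => F1 x * F1 x + - k ^ 2 * Rpower (F x) ((m + q) / m))).
    { intros x. simpl. ring. }
    replace 0 with (0 * 0 + - k ^ 2 * 0) by ring.
    apply filterlim_Rplus; [apply filterlim_Rmult; assumption|].
    apply filterlim_scal_R, HF0e, Rdiv_lt_0_compat; lra. }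
  assert (HEpos : forall k, 0 <= k < Y ->
            at_left X (fun x => k * Rpower (F x) ((m + q) / (2 * m)) <= - F1 x)).
  { intros k Hk.
    assert (Hlt : (m + q) / (2 * m) * k ^ 2 + be / m * w * k - Rpower X s < 0).
    { rewrite <- HYeq. assert (k ^ 2 < Y ^ 2) by nra.
      assert (0 <= be / m * w) by nra. nra. }
    generalize (filter_and _ _ Hin (filter_and _ _ Hdrift
      (filterlim_eventually_lt _ _ _ (Hdefect k) Hlt))).
    intros Hev. apply at_left_iff in Hev. destruct Hev as [A [HA Hev]].
    apply at_left_iff. exists A. split; [exact HA|]. intros x Hx.
    assert (HE : 0 < energy m q k F F1 x).
    { apply (barrier_positive _ (energy' n al be m q s k F F1) A X); try assumption.
      - intros y Hy. destruct (Hev y Hy) as [Hy0 _].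
        apply (is_derive_energy _ _ _ _ _ _ _ _ _ _ H); simpl; lra.
      - apply HE0.
      - intros y Hy HEy. destruct (Hev y Hy) as [Hy0 [Hc Hd]].
        apply energy'_neg; try lra.
        apply (dsol_neg _ _ _ _ _ _ _ _ _ _ H); simpl; lra. }
    destruct (Hev x Hx) as [Hx0 _].
    assert (F1 x + k * Rpower (F x) ((m + q) / (2 * m)) <= 0); [|lra].
    apply energy_nonneg; try lra.
    apply (dsol_neg _ _ _ _ _ _ _ _ _ _ H); simpl; lra. }
  assert (HEneg : forall k, Y < k ->
            at_left X (fun x => - F1 x <= k * Rpower (F x) ((m + q) / (2 * m)))).
  { intros k Hk.
    assert (Hlt : 0 < (m + q) / (2 * m) * k ^ 2 + be / m * w * k - Rpower X s).
    { rewrite <- HYeq. assert (Y ^ 2 < k ^ 2) by nra.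
      assert (0 <= be / m * w) by nra. nra. }
    generalize (filter_and _ _ Hin (filter_and _ _ Hdrift
      (filterlim_eventually_gt _ _ _ (Hdefect k) Hlt))).
    intros Hev. apply at_left_iff in Hev. destruct Hev as [A [HA Hev]].
    apply at_left_iff. exists A. split; [exact HA|]. intros x Hx.
    (* For [k > Y] the defect is eventually positive, so the barrier is applied to minus the
       energy. *)
    assert (HE : 0 < - energy m q k F F1 x).
    { apply (barrier_positive (fun x => - energy m q k F F1 x)
               (fun x => - energy' n al be m q s k F F1 x) A X); try assumption.
      - intros y Hy. destruct (Hev y Hy) as [Hy0 _].
        apply (is_derive_opp (energy m q k F F1)).
        apply (is_derive_energy _ _ _ _ _ _ _ _ _ _ H); simpl; lra.
      - apply (filterlim_ext (fun x => - 1 * energy m q k F F1 x)); [intros; ring|].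
        replace 0 with (- 1 * 0) by ring. apply filterlim_scal_R, HE0.
      - intros y Hy HEy. destruct (Hev y Hy) as [Hy0 [Hc Hd]].
        assert (0 < energy' n al be m q s k F F1 y); [|lra].
        apply energy'_pos; try lra.
        apply (dsol_neg _ _ _ _ _ _ _ _ _ _ H); simpl; lra. }
    destruct (Hev x Hx) as [Hx0 _].
    assert (0 <= F1 x + k * Rpower (F x) ((m + q) / (2 * m))); [|lra].
    apply energy_nonpos; try lra.
    apply (dsol_neg _ _ _ _ _ _ _ _ _ _ H); simpl; lra. }
  set (e := (m - q) / (2 * m)).
  assert (He : 0 < e) by (apply Rdiv_lt_0_compat; lra).
  assert (Hslope : filterlim (fun x => Rpower (F x) (e - 1) * F1 x) (at_left X)
                     (locally (- Y))).
  { apply filterlim_real_iff. intros d Hd.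
    (* The maximum with 0 keeps the lower slope admissible in [HEpos]; using [d / 2] turns the weak
       comparisons into strict ones. *)
    assert (Hm1 : 0 <= Rmax 0 (Y - d / 2) < Y)
      by (split; [apply Rmax_l|apply Rmax_lub_lt; lra]).
    assert (Hm2 : Y < Y + d / 2) by lra.
    generalize (filter_and _ _ HposX (filter_and _ _ (HEpos _ Hm1) (HEneg _ Hm2))).
    apply filter_imp. intros x [Hx1 [Hx2 Hx3]].
    assert (E : Rpower (F x) (e - 1) * Rpower (F x) ((m + q) / (2 * m)) = 1).
    { rewrite <- Rpower_plus. unfold e.
      replace ((m - q) / (2 * m) - 1 + (m + q) / (2 * m)) with 0 by (field; lra).
      apply Rpower_O, Hx1. }
    pose proof (Rpower_pos (F x) (e - 1)) as Hr.
    pose proof (Rmax_r 0 (Y - d / 2)).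
    apply (Rmult_le_compat_l (Rpower (F x) (e - 1))) in Hx2; [|lra].
    apply (Rmult_le_compat_l (Rpower (F x) (e - 1))) in Hx3; [|lra].
    split; nra. }
  assert (Hquot : filterlim (fun x => Rpower (F x) e / (X - x)) (at_left X)
                    (locally (e * Y))).
  { replace (e * Y) with (- (e * - Y)) by ring.
    apply (at_left_quotient _ (fun x => e * Rpower (F x) (e - 1) * F1 x) 0).
    - exact HX.
    - intros x Hx. apply is_derive_Rpower_comp.
      + apply (dsol_pos _ _ _ _ _ _ _ _ _ _ H); simpl; lra.
      + apply (dsol_derive _ _ _ _ _ _ _ _ _ _ H); simpl; lra.
    - apply HF0e, He.
    - apply (filterlim_ext (fun x => e * (Rpower (F x) (e - 1) * F1 x))); [intros; ring|].
      apply filterlim_scal_R, Hslope. }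
  set (p := 2 / (m - q)).
  (* Hence $f=(F^e)^p$, and the limit of $F^e/(X-x)$ can be raised to the power [p]. *)
  assert (Hpe : e * p = 1 / m) by (unfold e, p; field; lra).
  assert (HeY : 0 < e * Y) by nra.
  assert (Hfinal : filterlim (fun x => Rpower (Rpower (F x) e / (X - x)) p) (at_left X)
                     (locally (Rpower (e * Y) p))).
  { apply (filterlim_comp _ _ _ _ (fun t => Rpower t p) _ _ _ Hquot).
    apply continuous_Rpower, HeY. }
  intros d.
  generalize (filter_and _ _ (proj1 (filterlim_real_iff _ _) Hfinal d (cond_pos d)) Hin).
  apply filter_imp. intros x [Hx1 Hx2].
  assert (E : profile m F x = Rpower (Rpower (F x) e / (X - x)) p * Rpower (X - x) p).
  { unfold profile. rewrite Rpower_mult_distr.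
    - replace (Rpower (F x) e / (X - x) * (X - x)) with (Rpower (F x) e) by (field; lra).
      rewrite Rpower_mult, Hpe. reflexivity.
    - apply Rdiv_lt_0_compat; [apply Rpower_pos|lra].
    - lra. }
  rewrite E. unfold norm; simpl; unfold abs; simpl.
  rewrite <- Rmult_minus_distr_r, Rabs_mult.
  apply Rmult_le_compat_r; [apply Rabs_pos|].
  apply Rabs_le. lra.
Qed.

(** * From maximal solutions to decreasing solutions *)

Lemma is_derive_within_interior (D : R -> Prop) (f : R -> R) (x l : R) :
  locally x D -> is_derive_within D f x l -> is_derive f x l.
Proof.
  intros HD H. apply is_derive_Reals. intros e He.
  pose proof (proj1 (filterlim_real_iff _ _) H e He) as Hev.
  destruct (filter_and _ _ HD Hev) as [d Hd].
  exists d. intros h Hh Hlt.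
  destruct (Hd (x + h)) as [HDx Hq].
  { unfold ball; simpl; unfold AbsRing_ball, abs, minus, plus, opp; simpl.
    replace (x + h + - x) with h by ring. exact Hlt. }
  assert (Hne : x + h <> x) by lra.
  specialize (Hq Hne HDx). replace (x + h - x) with h in Hq by ring.
  apply Rabs_def1; lra.
Qed.

Lemma locally_dom (xm : Rbar) (x : R) : 0 < x -> Rbar_lt x xm -> locally x (dom xm).
Proof.
  intros H0 Hx. apply filter_and.
  - generalize (open_gt 0 x H0). apply filter_imp. intros y. apply Rlt_le.
  - destruct xm as [X| |]; simpl in *.
    + exact (open_lt X x Hx).
    + apply filter_true.
    + contradiction.
Qed.

(** The sign of [F1] remains a premise: it comes from membership in [setB], and is supplied
    separately for infinite and finite [xm]. *)
Lemma maximal_solution_decreasing N m q sigma a F xm :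
  is_maximal_solution N m q sigma a F xm ->
  exists F1 F2 : R -> R,
    (forall x : R, 0 < x -> Rbar_lt x xm -> is_derive F x (F1 x)) /\
    ((forall x : R, 0 < x -> Rbar_lt x xm -> F1 x < 0) ->
     decreasing_solution (INR N - 1) (alpha m q sigma) (beta m q sigma) m q sigma
       F F1 F2 xm).
Proof.
  intros S. destruct (sol_C2 _ _ _ _ _ _ _ S) as [F1 [F2 [H1 [H2 _]]]].
  assert (D1 : forall x : R, 0 < x -> Rbar_lt x xm -> is_derive F x (F1 x)).
  { intros x H0 Hx. apply (is_derive_within_interior (dom xm)).
    - apply locally_dom; assumption.
    - apply H1. split; [lra|exact Hx]. }
  assert (D2 : forall x : R, 0 < x -> Rbar_lt x xm -> is_derive F1 x (F2 x)).
  { intros x H0 Hx. apply (is_derive_within_interior (dom xm)).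
    - apply locally_dom; assumption.
    - apply H2. split; [lra|exact Hx]. }
  assert (Hpos : forall x : R, 0 < x -> Rbar_lt x xm -> 0 < F x).
  { intros x H0 Hx. apply (sol_pos _ _ _ _ _ _ _ S). split; [lra|exact Hx]. }
  exists F1, F2. split; [exact D1|]. intros Hneg.
  split; try assumption. intros x H0 Hx.
  rewrite <- (sol_ode _ _ _ _ _ _ _ S x H0 Hx).
  rewrite (is_derive_unique F x _ (D1 x H0 Hx)).
  rewrite (is_derive_unique (fun y : R => Rpower (F y) (1 / m)) x _
             (is_derive_Rpower_comp F x (F1 x) (1 / m) (Hpos x H0 Hx) (D1 x H0 Hx))).
  replace (Derive_n F 2 x) with (F2 x); [reflexivity|].
  symmetry. apply (is_derive_unique (Derive F)).
  (* [Derive F] is known to agree with [F1] only inside the interval, hence the local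
     extensionality. *)
  apply (is_derive_ext_loc F1); [|apply D2; assumption].
  assert (Hloc : locally x (fun y => 0 < y /\ Rbar_lt y xm)).
  { apply filter_and; [exact (open_gt 0 x H0)|].
    generalize (locally_dom xm x H0 Hx). apply filter_imp. intros y Hy. apply Hy. }
  revert Hloc. apply filter_imp. intros y [Hy0 Hy].
  symmetry. apply is_derive_unique, D1; assumption.
Qed.

(** If no admissible endpoint exceeded [x], then [x] would be an upper bound of the set whose least
    upper bound is [xi1]. *)
Lemma derive_neg_before_xi1 (F : R -> R) (xm : Rbar) (x : R) :
  0 < x -> Rbar_lt x (xi1 F xm) -> Rbar_lt x xm /\ Derive F x < 0.
Proof.
  intros H0 Hx.
  destruct (classic (exists z : R, x < z /\ Rbar_lt z xm /\
              forall y, 0 < y < z -> Derive F y < 0)) as [[z [Hz [Hzm Hneg]]]|Hn].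
  - split; [|apply Hneg; lra].
    apply (Rbar_lt_trans x z xm); [exact Hz|exact Hzm].
  - exfalso. apply (Rbar_lt_not_le _ _ Hx). unfold xi1.
    apply (proj2 (Lub_Rbar_correct _)). intros z [Hz0 [_ [Hzm Hneg]]].
    simpl. apply Rnot_lt_le. intros Hlt. apply Hn. exists z. tauto.
Qed.

Lemma setB_decreasing F xm a : setB F xm a ->
  forall x : R, 0 < x -> Rbar_lt x (xi0 (F a) (xm a)) ->
  Rbar_lt x (xm a) /\ Derive (F a) x < 0.
Proof.
  intros [Ha Hn] x H0 Hx. apply derive_neg_before_xi1; [exact H0|].
  eapply Rbar_lt_le_trans; [exact Hx|].
  apply Rbar_not_lt_le. intros HC. apply Hn. right. split; assumption.
Qed.

(** This turns a limit of $F'$ into the left derivative that [setA] asks for. *)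
Lemma extend0_derive_at_end (F F1 : R -> R) (X l : R) :
  0 < X -> (forall x, 0 < x < X -> is_derive F x (F1 x)) ->
  filterlim F (at_left X) (locally 0) -> filterlim F1 (at_left X) (locally l) ->
  is_derive_within (fun x => x < X) (extend0 F X) X l.
Proof.
  intros HX HD HF HF1.
  pose proof (filterlim_scal_R (-1) _ _ (at_left_quotient F F1 0 X l HX HD HF HF1)) as Hq.
  replace (-1 * - l) with l in Hq by ring.
  apply (filterlim_filter_le_1 (F := at_left X)).
  - intros P. unfold at_left, locally', within. apply filter_imp. intros x HP _. exact HP.
  - revert Hq. apply filterlim_ext_loc. apply at_left_iff. exists 0. split; [exact HX|].
    intros x Hx. unfold extend0.
    destruct (Rbar_lt_dec x X) as [_|Hn]; [|exfalso; apply Hn; simpl; lra].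
    destruct (Rbar_lt_dec X X) as [Hn|_]; [exfalso; simpl in Hn; lra|].
    field. lra.
Qed.

(** In both regimes the root is $Y=\frac{2m}{\sqrt{2m(m+q)}}X^{\sigma/2}B$, with $B=1$ or with $B$
    the base of the power [K2]. *)
Lemma amplitude_power (m q sigma X B : R) : 1 < m -> 0 < q < 1 -> 0 < X -> 0 < B ->
  Rpower ((m - q) / (2 * m)
            * (2 * m / sqrt (2 * m * (m + q)) * Rpower X (sigma / 2) * B)) (2 / (m - q))
  = K1 m q * Rpower X (sigma / (m - q)) * Rpower B (2 / (m - q)).
Proof.
  intros Hm Hq HX HB. unfold K1.
  assert (Hr : 0 < sqrt (2 * m * (m + q))) by (apply sqrt_lt_R0; nra).
  assert (Hk : 0 < (m - q) / sqrt (2 * m * (m + q))) by (apply Rdiv_lt_0_compat; lra).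
  replace (sigma / (m - q)) with (sigma / 2 * (2 / (m - q))) by (field; lra).
  rewrite <- Rpower_mult.
  pose proof (Rpower_pos X (sigma / 2)).
  rewrite !Rpower_mult_distr; try assumption.
  - f_equal. field. lra.
  - apply Rmult_lt_0_compat; assumption.
Qed.

(** * The expansion at the extinction point *)

Theorem proposition4p10 (N : nat) (m q sigma : R)
  (hN : (1 <= N)%nat) (hm : 1 < m) (hq : 0 < q < 1)
  (hsigma : 2 * (1 - q) / (m - 1) < sigma)
  (F : R -> R -> R) (xm : R -> Rbar)
  (hF : forall a : R, 0 < a -> is_maximal_solution N m q sigma a (F a) (xm a))
  (a : R) (ha : setB F xm a) (hmq : m + q <= 2) :
  exists x0 : R, xi0 (F a) (xm a) = Finite x0 /\
    (1 < m + q < 2 ->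
      left_expansion (profile m (F a)) x0
        (K1 m q * Rpower x0 (sigma / (m - q)))
        (2 / (m - q))) /\
    (m + q = 2 ->
      left_expansion (profile m (F a)) x0
        (K1 m q * Rpower x0 (sigma / (m - q))
         * K2 m q sigma (Rpower x0 ((2 - sigma) / 2)))
        (2 / (m - q))).
Proof.
  assert (hn : 0 <= INR N - 1) by (apply le_INR in hN; simpl in hN; lra).
  assert (hs : 2 * (1 - q) < sigma * (m - 1)).
  { apply (Rmult_lt_compat_r (m - 1)) in hsigma; [|lra].
    replace (2 * (1 - q) / (m - 1) * (m - 1)) with (2 * (1 - q)) in hsigma by (field; lra).
    exact hsigma. }
  (* From $m+q\le2$, $2(m-1)\le2(1-q)<\sigma(m-1)$. *)
  assert (hs2 : 2 < sigma) by nra.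
  assert (hal : 0 < alpha m q sigma) by (apply Rdiv_lt_0_compat; lra).
  assert (hbe : 0 < beta m q sigma) by (apply Rdiv_lt_0_compat; lra).
  pose proof (setB_decreasing F xm a ha) as Hdec.
  pose proof (hF a (proj1 ha)) as S.
  destruct (maximal_solution_decreasing _ _ _ _ _ _ _ S) as [F1 [F2 [HD Hsol]]].
  pose proof (sol_xm_pos _ _ _ _ _ _ _ S) as Hxm0.
  destruct (excluded_middle_informative (vanishes_at_end (F a) (xm a)))
    as [Hv|Hv].
  (* If [F a] did not vanish at the end, [xi0] would be infinite; then every positive [x] lies below
     [xm a], giving a global decreasing solution. *)
  2: { exfalso.
    assert (Hxi : xi0 (F a) (xm a) = p_infty).
    { unfold xi0. destruct (excluded_middle_informative _);
        [contradiction|reflexivity]. }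
    rewrite Hxi in Hdec.
    assert (Hinf : xm a = p_infty).
    { destruct (xm a) as [X| |]; [|reflexivity|contradiction].
      destruct (Hdec X Hxm0 I) as [Hlt _]. simpl in Hlt. lra. }
    rewrite Hinf in *.
    apply (no_global_decreasing_solution (INR N - 1) (alpha m q sigma) (beta m q sigma)
             m q sigma (F a) F1 F2); try assumption.
    apply Hsol. intros x Hx Hxx. rewrite <- (is_derive_unique _ _ _ (HD x Hx Hxx)).
    apply Hdec; assumption. }
  assert (Hxi : xi0 (F a) (xm a) = xm a).
  { unfold xi0. destruct (excluded_middle_informative _);
      [reflexivity|contradiction]. }
  rewrite Hxi in Hdec. destruct Hv as [X [HX HF0]]. rewrite HX in *.
  simpl in Hxm0.
  assert (H : decreasing_solution (INR N - 1) (alpha m q sigma) (beta m q sigma) m q sigma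
                (F a) F1 F2 X).
  { apply Hsol. intros x Hx Hxx. rewrite <- (is_derive_unique _ _ _ (HD x Hx Hxx)).
    apply Hdec; assumption. }
  destruct (derivative_at_extinction _ _ _ m _ _ _ _ _ X hn (Rlt_le _ _ hal)
              (Rlt_le _ _ hbe) ltac:(lra) Hxm0 H HF0) as [l Hl].
  assert (Hin : at_left X (fun x => 0 < x < X))
    by (apply at_left_iff; exists 0; split; [lra|trivial]).
  (* A negative limit would be a negative left derivative at [X], placing [a] in [setA]. *)
  assert (Hl0 : l = 0).
  { apply Rle_antisym.
    - apply (filterlim_le (F := at_left X) F1 (fun _ => 0) (Finite l) (Finite 0)).
      + revert Hin. apply filter_imp. intros x Hx. apply Rlt_le.
        apply (dsol_neg _ _ _ _ _ _ _ _ _ _ H); simpl; lra.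
      + exact Hl.
      + apply filterlim_const.
    - apply Rnot_lt_le. intros Hneg. apply (proj2 ha). left. split; [apply ha|].
      exists X. split; [rewrite HX; exact Hxi|]. split.
      + intros x Hx. apply Hdec; simpl; lra.
      + exists l. split; [exact Hneg|]. rewrite HX.
        apply (extend0_derive_at_end _ F1); try assumption.
        intros x Hx. apply HD; simpl; lra. }
  subst l.
  exists X. split; [exact Hxi|].
  set (r := sqrt (2 * m * (m + q))).
  set (t := Rpower X (sigma / 2)).
  assert (Hr : 0 < r) by (apply sqrt_lt_R0; nra).
  assert (Hr2 : r * r = 2 * m * (m + q)) by (apply sqrt_sqrt; nra).
  assert (Ht : 0 < t) by apply Rpower_pos.
  assert (Htt : t * t = Rpower X sigma).
  { unfold t. rewrite <- Rpower_plus. f_equal. field. }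
  assert (Hid : filterlim (fun x : R => x) (at_left X) (locally X))
    by apply (filterlim_at_left_continuous (fun x => x)), continuous_id.
  assert (Hpos : at_left X (fun x => 0 < F a x)).
  { revert Hin. apply filter_imp. intros x Hx.
    apply (dsol_pos _ _ _ _ _ _ _ _ _ _ H); simpl; lra. }
  split; intros Hmq.
  (* Case $m+q<2$: here $w=0$ and $B=1$; the factor [Rpower 1 _] is inserted to match
     [amplitude_power]. *)
  - replace (K1 m q * Rpower X (sigma / (m - q)))
      with (K1 m q * Rpower X (sigma / (m - q)) * Rpower 1 (2 / (m - q))).
    2: { unfold Rpower at 2. rewrite ln_1, Rmult_0_r, exp_0. ring. }
    rewrite <- amplitude_power by lra. fold r t.
    apply (extinction_rate _ _ _ _ _ _ _ _ _ X 0 (2 * m / r * t * 1) hbe hm hq Hxm0 H);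
      try assumption; try lra.
    + replace 0 with (X * 0) by ring. apply filterlim_Rmult; [exact Hid|].
      apply filterlim_Rpower_0; try assumption. apply Rdiv_lt_0_compat; lra.
    + rewrite Rmult_1_r. apply Rmult_lt_0_compat; [apply Rdiv_lt_0_compat|]; lra.
    + rewrite <- Htt.
      replace ((m + q) / (2 * m) * (2 * m / r * t * 1) ^ 2
               + beta m q sigma / m * 0 * (2 * m / r * t * 1))
        with ((2 * m * (m + q)) / (r * r) * (t * t)) by (field; lra).
      rewrite Hr2. field. lra.
  - set (z := Rpower X ((2 - sigma) / 2)).
    (* Case $m+q=2$: here $w=X=zt$. Substituting $Y=\frac{2m}{r}tB$ and dividing by $t^2$ turns the
       equation for the root into $B^2+2cB=1$, whose positive solution is $\sqrt{1+c^2}-c$. *)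
    set (c := beta m q sigma * z / r).
    set (B := sqrt (1 + c ^ 2) - c).
    assert (Hzt : z * t = X).
    { unfold z, t. rewrite <- Rpower_plus.
      replace ((2 - sigma) / 2 + sigma / 2) with 1 by field. apply Rpower_1, Hxm0. }
    assert (Hc : 0 < c).
    { unfold c. apply Rdiv_lt_0_compat; [|exact Hr].
      apply Rmult_lt_0_compat; [exact hbe|apply Rpower_pos]. }
    assert (Hsq : sqrt (1 + c ^ 2) * sqrt (1 + c ^ 2) = 1 + c ^ 2)
      by (apply sqrt_sqrt; nra).
    assert (HB : 0 < B).
    { unfold B. pose proof (sqrt_pos (1 + c ^ 2)). nra. }
    assert (HBeq : B ^ 2 + 2 * c * B = 1) by (unfold B; nra).
    replace (K2 m q sigma z) with (Rpower B (2 / (m - q))).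
    2: { unfold K2, B. fold r. f_equal. f_equal. f_equal. f_equal.
         rewrite <- Hr2. unfold c. field. lra. }
    rewrite <- amplitude_power by lra. fold r t.
    apply (extinction_rate _ _ _ _ _ _ _ _ _ X X (2 * m / r * t * B) hbe hm hq Hxm0 H);
      try assumption; try lra.
    + revert Hid. apply filterlim_ext_loc. revert Hpos. apply filter_imp. intros x Hx.
      replace ((2 - m - q) / (2 * m)) with 0.
      * rewrite Rpower_O by exact Hx. ring.
      * replace (2 - m - q) with 0 by lra. field. lra.
    + apply Rmult_lt_0_compat; [|exact HB].
      apply Rmult_lt_0_compat; [apply Rdiv_lt_0_compat|]; lra.
    + rewrite <- Htt. rewrite <- Hzt at 1.
      assert (Hbc : beta m q sigma * z = c * r) by (unfold c; field; lra).
      replace ((m + q) / (2 * m) * (2 * m / r * t * B) ^ 2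
               + beta m q sigma / m * (z * t) * (2 * m / r * t * B))
        with (t * t * ((2 * m * (m + q)) / (r * r) * B ^ 2
                       + 2 * (beta m q sigma * z) / r * B)) by (field; lra).
      rewrite Hr2, Hbc.
      replace (2 * m * (m + q) / (2 * m * (m + q)) * B ^ 2 + 2 * (c * r) / r * B)
        with (B ^ 2 + 2 * c * B) by (field; lra).
      rewrite HBeq. ring.
Qed.
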